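(* Let $\Delta,k$ be positive integers and let $c_1,c_2$ be constants such that every graph with no subgraph isomorphic to a subdivision of the $(k\times k)$-wall has treewidth at most $c_1k^9\log^{c_2}k$ (for every $k$). Let $w(\Delta,k)=\max\{c_1k^9\log^{c_2}k\,(\Delta+1)^2,\ 6(\Delta+1)\}-1$. Then every claw-free graph $G$ of maximum degree at most $\Delta$ with no induced subgraph isomorphic to the line graph of a subdivision of the $(k\times k)$-wall satisfies $\mathrm{tw}(G)\le w(\Delta,k)$.
   Context: Claw-free means no induced subgraph isomorphic to $K_{1,3}$. Such constants $c_1,c_2$ exist (a theorem of Chuzhoy and Tan). The $(k\times k)$-wall $W_{k\times k}$ is the case $n=m=k$ of: $W_{n\times m}$ has vertex set $\{(1,2j-1):1\le j\le m\}\cup\{(i,j):1<i<n,\ 1\le j\le 2m\}$ plus $\{(n,2j-1):1\le j\le m\}$ if $n$ is even or $\{(n,2j):1\le j\le m\}$ if $n$ is odd; edges $(1,2j-1)(1,2j+1)$ ($1\le j\le m-1$), $(i,j)(i,j+1)$ ($2\le i<n$, $1\le j<2m$), $(n,2j)(n,2j+2)$ ($1\le j<m$, $n$ odd), $(n,2j-1)(n,2j+1)$ ($1\le j<m$, $n$ even), and $(i,j)(i+1,j)$ ($1\le i<n$, $i,j$ both odd or both even, when both vertices exist). Subdivision replaces edges by paths; line graph $L(F)$ has vertex set $E(F)$ with adjacency meaning sharing an end. $\mathrm{tw}$ is treewidth. *)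

(* Defs.v *)
(* MathComp / MathComp-Analysis. *)
From HB Require Import structures.
From mathcomp Require Import all_boot all_order all_algebra.
From mathcomp Require Import boolp reals exp.

Set Implicit Arguments.
Unset Strict Implicit.
Unset Printing Implicit Defensive.

Import Order.TTheory GRing.Theory Num.Theory.

(** * Finite simple graphs *)

Record sgraph := SGraph {
  vertex :> finType;
  adj : rel vertex;
  adj_sym : symmetric adj;
  adj_irr : irreflexive adj }.

Definition max_degree_le (G : sgraph) (d : nat) : Prop :=
  forall x : G, #|[set y | adj x y]| <= d.

(* [G] has a subgraph isomorphic to [F]: the subgraph is the image of [f]. *)
Definition has_subgraph (G F : sgraph) : Prop :=
  exists f : F -> G,
    injective f /\ forall x y, adj x y -> adj (f x) (f y).

(* [G] has an induced subgraph isomorphic to [F]: it is induced by the image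
   of [f]. *)
Definition has_induced_subgraph (G F : sgraph) : Prop :=
  exists f : F -> G,
    injective f /\ forall x y, adj (f x) (f y) = adj x y.

Definition complete_bipartite_adj (m n : nat) : rel ('I_m + 'I_n) :=
  fun x y => match x, y with
             | inl _, inr _ | inr _, inl _ => true
             | _, _ => false
             end.

Lemma complete_bipartite_sym m n : symmetric (@complete_bipartite_adj m n).
Proof. by case=> ? [] ?. Qed.

Lemma complete_bipartite_irr m n : irreflexive (@complete_bipartite_adj m n).
Proof. by case. Qed.

Definition complete_bipartite (m n : nat) : sgraph :=
  SGraph (@complete_bipartite_sym m n) (@complete_bipartite_irr m n).

Definition claw_free (G : sgraph) : Prop :=
  ~ has_induced_subgraph G (complete_bipartite 1 3).

(** * Line graphs *)

Definition edges (F : sgraph) : {set {set F}} :=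
  [set [set p.1; p.2] | p : F * F & adj p.1 p.2].

Definition line_adj (F : sgraph) : rel {A : {set F} | A \in edges F} :=
  fun A B => (A != B) && (val A :&: val B != set0).

Lemma line_adj_sym (F : sgraph) : symmetric (@line_adj F).
Proof. by move=> A B; rewrite /line_adj eq_sym setIC. Qed.

Lemma line_adj_irr (F : sgraph) : irreflexive (@line_adj F).
Proof. by move=> A; rewrite /line_adj eqxx. Qed.

Definition line_graph (F : sgraph) : sgraph :=
  SGraph (@line_adj_sym F) (@line_adj_irr F).

(** * Subdivisions *)

(* The edge [xy] of [F] is replaced by the path [b x :: rcons (P x y) (b y)] of
   [H], so that [P x y] lists its (possibly empty) interior; [P y x] is the same
   path read backwards.  The last two clauses say that [H] has no other vertices
   and no other edges. *)
Definition is_subdivision (F H : sgraph) : Prop :=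
  exists (b : F -> H) (P : F -> F -> seq H),
  [/\ injective b,
      forall x y, adj x y ->
        [/\ path (@adj H) (b x) (rcons (P x y) (b y)),
            uniq (P x y),
            forall z, b z \notin P x y
          & P y x = rev (P x y)],
      forall x y x' y', adj x y -> adj x' y' ->
        [set x; y] != [set x'; y'] ->
        forall u, ~~ ((u \in P x y) && (u \in P x' y')),
      forall u : H, (exists x, u = b x) \/
                    (exists x y, adj x y /\ u \in P x y)
    & forall u v : H, adj u v ->
        exists x y, adj x y /\
          infix [:: u; v] (b x :: rcons (P x y) (b y)) ].

(** * Walls *)

(* Coordinates start at 1, as in the usual drawing; the value 0 of the ordinals
   below is never used.  The first row consists of the [(1, j)] with [j] odd,
   [1 <= j <= 2m - 1]; the last one of the [(n, j)] with [j] of parity opposite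
   to that of [n]. *)
Definition wall_vertex (n m i j : nat) : bool :=
  [|| [&& i == 1, odd j & j < 2 * m],
      [&& 1 < i < n & 1 <= j <= 2 * m]
    | (i == n) && (if odd n then ~~ odd j && (1 < j <= 2 * m)
                   else odd j && (j < 2 * m))].

(* Each edge in one of its two orientations. *)
Definition wall_arc (n m i j i' j' : nat) : bool :=
  [|| [&& i == 1, i' == 1, odd j, j' == j + 2 & j' < 2 * m],
      [&& 1 < i < n, i' == i, j' == j + 1 & 1 <= j < 2 * m],
      [&& i == n, i' == n, odd j != odd n, j' == j + 2 & j' <= 2 * m]
    | [&& 1 <= i < n, i' == i + 1, j' == j & odd i == odd j]].

Definition wall_type (n m : nat) : finType :=
  {p : 'I_n.+1 * 'I_(2 * m).+1 | wall_vertex n m p.1 p.2}.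

Definition wall_adj (n m : nat) : rel (wall_type n m) :=
  fun p q => let: (i, j) := val p in let: (i', j') := val q in
    wall_arc n m i j i' j' || wall_arc n m i' j' i j.

Lemma wall_adj_sym n m : symmetric (@wall_adj n m).
Proof.
by move=> p q; rewrite /wall_adj; case: (val p) (val q) => ? ? [? ?]; rewrite orbC.
Qed.

Lemma wall_adj_irr n m : irreflexive (@wall_adj n m).
Proof.
move=> p; rewrite /wall_adj; case: (val p) => i j; rewrite orbb /wall_arc.
by rewrite -[X in X == j + 2]addn0 -[X in X == j + 1]addn0 -[X in X == i + 1]addn0
  !eqn_add2l /= !andbF.
Qed.

Definition wall (n m : nat) : sgraph :=
  SGraph (@wall_adj_sym n m) (@wall_adj_irr n m).

(** * Treewidth *)

Definition is_tree (T : sgraph) : Prop :=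
  [/\ 0 < #|T|,
      forall s t : T, connect (@adj T) s t
    & forall c : seq T, 2 < size c -> ~ ucycle (@adj T) c].

Definition is_tree_decomposition (G T : sgraph) (B : T -> {set G}) : Prop :=
  [/\ is_tree T,
      forall x : G, exists t, x \in B t,
      forall x y : G, adj x y -> exists t, (x \in B t) && (y \in B t)
    & forall (x : G) (s t : T), x \in B s -> x \in B t ->
        connect [rel a b | [&& adj a b, x \in B a & x \in B b]] s t].

Definition has_decomposition_of_size (G : sgraph) (n : nat) : Prop :=
  exists (T : sgraph) (B : T -> {set G}),
    is_tree_decomposition B /\ \max_(t : T) #|B t| = n.

Lemma unit_adj_sym : symmetric (fun _ _ : unit => false).
Proof. by []. Qed.

Lemma unit_adj_irr : irreflexive (fun _ _ : unit => false).
Proof. by []. Qed.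

Lemma has_decomposition (G : sgraph) :
  exists n, `[< has_decomposition_of_size G n >].
Proof.
exists #|G|; apply/asboolP.
exists (SGraph unit_adj_sym unit_adj_irr), (fun=> [set: G]); split.
  split.
  - split; first by rewrite card_unit.
    + by case=> [] [].
    + by case=> [|? [|? ?]] //= _ /andP[].
  - by move=> x; exists tt; rewrite inE.
  - by move=> x y _; exists tt; rewrite !inE.
  - by move=> x [] [].
by rewrite (big_pred1 tt) ?cardsT // => -[].
Qed.

(* The least width of a tree decomposition, where the width is the size of a
   largest bag minus one; it is an integer since the empty graph has treewidth
   -1. *)
Definition treewidth (G : sgraph) : int :=
  ((ex_minn (has_decomposition G))%:Z - 1)%R.

(** * The bounds *)

Local Open Scope ring_scope.

Definition wall_bound (R : realType) (c1 c2 : R) (k : nat) : R :=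
  c1 * k%:R ^+ 9 * (ln (k%:R : R)) `^ c2.

Definition w_bound (R : realType) (c1 c2 : R) (Delta k : nat) : R :=
  Num.max (wall_bound c1 c2 k * (Delta.+1)%:R ^+ 2) (6 * (Delta.+1)%:R) - 1.

(* Main.v *)
(* Fix a maximal independent set [I].  By claw-freeness a vertex outside [I] has
   one or two neighbours in [I], and two adjacent vertices outside [I] with no
   common neighbour in [I] have one neighbour each.  Adjacencies of the latter
   kind form components that are cliques or meet only two classes, a class being
   the set of vertices with a given unique neighbour in [I].  Choose one
   representative per component and class, and one per pair of elements of [I]
   that have a common neighbour and whose classes share no component.  The
   representatives adjacent to a given element of [I] form at most two cliques, so
   that [I] and the representatives induce the line graph of a graph [H], whose
   nodes are the components and two nodes for each element of [I].  A wall
   subdivision in [H] thus gives its line graph in [G], without passing to a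
   further subdivision.  Conversely, replacing each node of [H] by at most
   (Delta + 1)^2 / 2 vertices of [G] turns tree decompositions of [H] into tree
   decompositions of [G]; since (s + 1) / 2 <= s for the treewidth s >= 1 of [H],
   this gives tw(G) + 1 <= (Delta + 1)^2 tw(H). *)

Require Import Defs.
From HB Require Import structures.
From mathcomp Require Import all_boot all_order all_algebra.
From mathcomp Require Import boolp reals exp.
From mathcomp Require Import zify.

Set Implicit Arguments.
Unset Strict Implicit.
Unset Printing Implicit Defensive.

Import Order.TTheory GRing.Theory Num.Theory.

(** * Claws, Krausz partitions and tree decompositions in general graphs *)

Lemma connect_invariant (T : finType) (e : rel T) (P : T -> Prop) x y :
  (forall u v, P u -> e u v -> P v) -> P x -> connect e x y -> P y.
Proof.
move=> Pe Px /connectP[p ep ->{y}].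
by elim: p x Px ep => //= z p IHp x Px /andP[/(Pe _ _ Px) Pz /(IHp z Pz)].
Qed.

Lemma claw_free_nbrs (G : sgraph) (a x y z : G) :
  claw_free G -> adj a x -> adj a y -> adj a z -> x != y -> x != z -> y != z ->
  [|| adj x y, adj x z | adj y z].
Proof.
move=> clawG ax ay az xy xz yz; apply: contraT.
rewrite !negb_or => /and3P[/negbTE nxy /negbTE nxz /negbTE nyz].
have nN (u v : G) : adj u v -> (u == v) = false :> bool.
  by move=> uv; apply/eqP=> eq_uv; rewrite eq_uv adj_irr in uv.
case: clawG.
pose g (i : 'I_3) := nth a [:: x; y; z] i.
have ag i : adj a (g i) by case: i => [[|[|[|]]] //].
have gg i j : adj (g i) (g j) = false.
  case: i j => [[|[|[|]]] // ?] [[|[|[|]]] // ?];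
  by rewrite /g /= ?adj_irr // adj_sym.
have g_inj : injective g.
  move=> i j gij; apply: val_inj; move: gij.
  case: i j => [[|[|[|]]] // ?] [[|[|[|]]] // ?] /eqP; rewrite /g /= ?(negbTE xy)
    ?(negbTE xz) ?(negbTE yz) //= eq_sym ?(negbTE xy) ?(negbTE xz) ?(negbTE yz) //.
exists (fun u => match u with inl _ => a | inr i => g i end); split; last first.
  move=> [i|i] [j|j]; rewrite /= ?adj_irr ?gg ?ag //.
  by rewrite adj_sym ag.
move=> [i|i] [j|j] //=.
- by rewrite (ord1 i) (ord1 j).
- by move/eqP; rewrite (nN _ _ (ag j)).
- by move/eqP; rewrite eq_sym (nN _ _ (ag i)).
- by move=> /g_inj ->.
Qed.

Lemma maximal_independent_set (G : sgraph) :
  exists I : {set G}, (forall i j, i \in I -> j \in I -> ~~ adj i j) /\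
    forall v, v \notin I -> exists2 i, i \in I & adj v i.
Proof.
pose indep (A : {set G}) := [forall i in A, forall j in A, ~~ adj i j].
have [|I /maxsetP[indI maxI]] := @ex_maxset _ indep.
  by exists set0; apply/forall_inP=> i; rewrite inE.
have indIE i j : i \in I -> j \in I -> ~~ adj i j.
  by move=> /(forall_inP indI) /forall_inP; apply.
exists I; split=> // v vI.
have [/existsP[i /andP[]]|/existsPn noi] := boolP [exists i, (i \in I) && adj v i].
  by exists i.
have nvi i : i \in I -> ~~ adj v i by move=> iI; move: (noi i); rewrite iI.
have : v |: I = I.
  apply: maxI (subsetUr _ _).
  apply/forall_inP=> i; rewrite !inE => /orP[/eqP->|iI]; apply/forall_inP=> j;
  rewrite !inE => /orP[/eqP->|jI] //.
  - by rewrite adj_irr.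
  - exact: nvi.
  - by rewrite adj_sym nvi.
  - exact: indIE.
by move/setP/(_ v); rewrite !inE eqxx (negbTE vI).
Qed.

(* The hypotheses say that the sets [Cl n] are a Krausz partition of the edges of
   an induced subgraph of [G] into cliques, with [H] as root graph. *)
Lemma line_graph_of_krausz (G H S : sgraph) (Cl : H -> {set G}) :
  (forall n m, adj n m -> exists x, (x \in Cl n) && (x \in Cl m)) ->
  (forall x n m k, x \in Cl n -> x \in Cl m -> x \in Cl k ->
     [|| n == m, n == k | m == k]) ->
  (forall x y n m, x != y -> x \in Cl n -> y \in Cl m ->
     adj x y <-> exists k, (x \in Cl k) && (y \in Cl k)) ->
  has_subgraph H S -> has_induced_subgraph G (line_graph S).
Proof.
move=> adjCl le2Cl ClE [f [f_inj f_adj]].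
(* An edge [pq] of [S] is sent to a vertex common to [Cl (f p)] and [Cl (f q)]. As no vertex lies in
   three of the sets, these two are the only ones containing it, so the image determines the
   edge. *)
have /fin_all_exists[g gP] (A : {A : {set S} | A \in edges S}) :
    exists x, forall n, (x \in Cl n) = (n \in f @: val A).
  case: A => A /= /imsetP[[p q]]; rewrite inE /= => pq ->.
  have /adjCl[x /andP[xp xq]] := f_adj _ _ pq.
  have fpq : f p != f q.
    by apply: contraTneq (f_adj _ _ pq) => ->; rewrite adj_irr.
  exists x => n; apply/idP/imsetP => [xn|[r]].
    have /or3P[] := le2Cl _ _ _ _ xp xq xn; first by rewrite (negbTE fpq).
    - by move=> /eqP <-; exists p; rewrite ?set21.
    - by move=> /eqP <-; exists q; rewrite ?set22.
  by rewrite !inE => /orP[] /eqP-> ->.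
have g_inj : injective g.
  move=> A B gAB; apply/val_inj/(imset_inj f_inj)/setP => n.
  by rewrite -!gP gAB.
have ne A : exists n, g A \in Cl n.
  case: A (gP A) => A AE gA; case/imsetP: (AE) => -[p q] _ /= defA.
  by exists (f p); rewrite gA; apply: imset_f; rewrite /= defA set21.
exists g; split=> // A B; rewrite /= /line_adj.
have [->|nAB] /= := eqVneq A B; first by rewrite adj_irr.
have ngAB : g A != g B by rewrite (inj_eq g_inj).
have [[n gn] [m gm]] := (ne A, ne B).
apply/idP/set0Pn=> [/(ClE _ _ _ _ ngAB gn gm)[k]|[r]].
  rewrite !gP => /andP[/imsetP[r rA ->]].
  by rewrite mem_imset // => rB; exists r; rewrite inE rA.
rewrite inE => /andP[rA rB]; apply/(ClE _ _ _ _ ngAB gn gm).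
by exists (f r); rewrite !gP !imset_f.
Qed.

Lemma leq_card_bigcup (T I : finType) (A : {pred I}) (F : I -> {set T}) :
  #|\bigcup_(i in A) F i| <= \sum_(i in A) #|F i|.
Proof.
elim/big_rec2: _ => [|i n B _ IH]; first by rewrite cards0.
by apply: leq_trans (leq_card_setU _ _) _; rewrite leq_add2l.
Qed.

(** Every node in a bag of [H] is replaced by its set [W n]. The bags containing [x] are then those
    meeting the nodes [n] with [x \in W n]; these nodes are connected in [H], and adjacent nodes
    share a bag. The factors 2 avoid halving [M], which may be odd. *)
Lemma decomposition_blowup (G H : sgraph) (W : H -> {set G}) (M m : nat) :
  (forall x, exists n, x \in W n) ->
  (forall x y, adj x y -> exists n, (x \in W n) && (y \in W n)) ->
  (forall x n n', x \in W n -> x \in W n' ->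
     connect [rel a b | [&& adj a b, x \in W a & x \in W b]] n n') ->
  (forall n, 2 * #|W n| <= M) ->
  has_decomposition_of_size H m ->
  exists2 m', has_decomposition_of_size G m' & 2 * m' <= m * M.
Proof.
move=> Wv We Wc WM [T [B [[treeT Bv Be Bc] maxB]]].
pose B' t := \bigcup_(n in B t) W n.
exists (\max_(t : T) #|B' t|); last first.
  rewrite (big_morph (muln 2) (@maxnMr 2) (muln0 2)).
  apply/bigmax_leqP => t _; apply: (@leq_trans (#|B t| * M)); last first.
    by rewrite leq_mul2r -maxB (leq_bigmax t) orbT.
  apply: (@leq_trans (2 * \sum_(n in B t) #|W n|)).
    by rewrite leq_mul2l /= leq_card_bigcup.
  by rewrite big_distrr /= -sum_nat_const leq_sum.
exists T, B'; split=> //; split=> //.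
- move=> x; have [n xn] := Wv x; have [t nt] := Bv n.
  by exists t; apply/bigcupP; exists n.
- move=> x y /We[n /andP[xn yn]]; have [t nt] := Bv n.
  by exists t; apply/andP; split; apply/bigcupP; exists n.
move=> x s t /bigcupP[n ns xn] /bigcupP[n' nt xn'].
set e := [rel a b | _ ].
have sub k a b : x \in W k -> k \in B a -> k \in B b -> connect e a b.
  move=> xk ka kb; apply: (connect_sub _ (Bc k a b ka kb)) => c d /=.
  case/and3P=> cd kc kd; apply: connect1; rewrite /= cd /=.
  by apply/andP; split; apply/bigcupP; exists k.
(* The property that every bag containing [k] is reachable from [s] passes from a node [k] to a
   neighbour of it, through a bag that contains both. *)
suff: x \in W n' /\ forall b, n' \in B b -> connect e s b by case=> _; apply.
apply: (connect_invariant (P := fun k => x \in W k /\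
   forall b, k \in B b -> connect e s b)) (Wc x n n' xn xn').
  move=> u v [xu su] /= /and3P[/Be[c /andP[uc vc]] _ xv]; split=> // b vb.
  exact: connect_trans (su c uc) (sub v c b xv vc vb).
by split=> // b; apply: sub.
Qed.

Lemma decomposition_size_edge (H : sgraph) (n m : H) (s : nat) :
  adj n m -> has_decomposition_of_size H s -> 2 <= s.
Proof.
move=> nm [T [B [[_ _ Be _] <-]]]; have [t /andP[nt mt]] := Be _ _ nm.
apply: leq_trans (leq_bigmax t).
rewrite -(_ : #|[set n; m]| = 2).
  by apply/subset_leq_card/subsetP => x; rewrite !inE => /orP[] /eqP->.
by rewrite cards2; case: eqVneq nm => // ->; rewrite adj_irr.
Qed.

(** * Adjacencies between vertices with different unique neighbours in the independent set *)

Section IndependentSet.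

Variables (G : sgraph) (I : {set G}).
Hypothesis clawG : claw_free G.
Hypothesis indI : forall i j, i \in I -> j \in I -> ~~ adj i j.
Hypothesis domI : forall v, v \notin I -> exists2 i, i \in I & adj v i.

Definition nbrs_in v : {set G} := [set i in I | adj v i].

(** Classes are compared through the sets [nbrs_in], which are singletons here. Among adjacent
    vertices outside [I], this relation captures exactly those without a common neighbour in [I], by
    [private_adj_of_disjoint] below. *)
Definition private_adj : rel G := fun u v =>
  [&& #|nbrs_in u| == 1, #|nbrs_in v| == 1, nbrs_in u != nbrs_in v & adj u v].

Local Notation nbI := nbrs_in.
Local Notation cross := private_adj.
Local Notation comp_root := (fingraph.root private_adj).
Local Notation conn := (connect private_adj).

Lemma nbrs_inP v i : reflect (i \in I /\ adj v i) (i \in nbI v).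
Proof. by rewrite inE; apply: andP. Qed.

Lemma nbrs_in_self v : v \in I -> nbI v = set0.
Proof.
move=> vI; apply/setP=> i; rewrite !inE; apply/negP => /andP[iI].
by apply/negP/indI.
Qed.

(** Maximality of [I] gives one neighbour; three would be the leaves of a claw, as [I] is
    independent. *)
Lemma card_nbrs_in v : v \notin I -> #|nbI v| = 1 \/ #|nbI v| = 2.
Proof.
move=> vI; have [i iI vi] := domI vI.
have : 0 < #|nbI v| by apply/card_gt0P; exists i; apply/nbrs_inP.
have [|] := leqP #|nbI v| 2; first by case: #|nbI v| => [|[|[|n]]] // _ _; [left|right].
case/card_gt2P=> x [y [z [[/nbrs_inP[xI vx] /nbrs_inP[yI vy] /nbrs_inP[zI vz]]]]].
case=> xy yz zx; have zx' : x != z by rewrite eq_sym.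
have /or3P[] := claw_free_nbrs clawG vx vy vz xy zx' yz => a _.
- by case/negP: (indI xI yI).
- by case/negP: (indI xI zI).
- by case/negP: (indI yI zI).
Qed.

Lemma private_adj_sym : symmetric cross.
Proof. by move=> u v; rewrite /private_adj andbCA [nbI u == _]eq_sym adj_sym. Qed.

Lemma conn_sym : connect_sym cross.
Proof. exact/sym_connect_sym/private_adj_sym. Qed.

(** If one end had two neighbours in [I], these and the other end would be the leaves of a claw. *)
Lemma private_adj_of_disjoint u v :
  u \notin I -> v \notin I -> adj u v -> [disjoint nbI u & nbI v] -> cross u v.
Proof.
move=> uI vI uv dis.
have one x y : x \notin I -> adj x y -> [disjoint nbI x & nbI y] -> y \notin I ->
    #|nbI x| = 1.
  move=> xI xy dxy yI; case: (card_nbrs_in xI) => // /eqP/cards2P[i [j [ij E]]].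
  have ix : i \in nbI x by rewrite E set21.
  have jx : j \in nbI x by rewrite E set22.
  have nI k : k \in nbI x -> (k != y) && ~~ adj k y.
    move=> kx; have /nbrs_inP[kI xk] := kx; rewrite adj_sym; apply/andP; split.
      by apply: contraNneq yI => <-.
    by apply: contraFN (disjointFr dxy kx) => yk; apply/nbrs_inP.
  have /nbrs_inP[iI xi] := ix; have /nbrs_inP[jI xj] := jx.
  have /andP[iy /negbTE niy] := nI i ix; have /andP[jy /negbTE njy] := nI j jx.
  have := claw_free_nbrs clawG xi xj xy ij iy jy.
  by rewrite niy njy (negbTE (indI iI jI)).
have u1 : #|nbI u| = 1 by apply: (one u v).
have v1 : #|nbI v| = 1 by apply: (one v u) => //; rewrite 1?adj_sym 1?disjoint_sym.
rewrite /private_adj u1 v1 uv !eqxx andbT /=; apply: contraTneq dis => ->.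
by rewrite -setI_eq0 setIid -cards_eq0 v1.
Qed.

(** Otherwise [y], [z] and the unique neighbour of [x] in [I] would be the leaves of a claw at
    [x]. *)
Lemma private_adj_nbrs x y z : cross x y -> cross x z -> y != z -> adj y z.
Proof.
move=> cxy cxz yz; case/and4P: (cxy) (cxz) => /cards1P[i Ei] _ _ xy /and4P[_ _ _ xz].
have /nbrs_inP[iI xi] : i \in nbI x by rewrite Ei set11.
have ni w : cross x w -> (i != w) && ~~ adj i w.
  case/and4P=> _ /cards1P[j Ej]; rewrite Ei Ej => ij xw; apply/andP; split.
    apply: contraTneq (set11 j) => iw; rewrite -Ej -iw nbrs_in_self // inE //.
  apply: contraNN ij => iw; apply/eqP/setP => k.
  have : i \in nbI w by apply/nbrs_inP; rewrite adj_sym.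
  by rewrite Ej inE => /eqP->.
have /andP[iy /negbTE niy] : (i != y) && ~~ adj i y by exact: ni.
have /andP[iz /negbTE niz] : (i != z) && ~~ adj i z by exact: ni.
by have := claw_free_nbrs clawG xi xy xz iy iz yz; rewrite niy niz.
Qed.

Lemma private_adj_trans x y z :
  cross x y -> cross x z -> nbI y != nbI z -> cross y z.
Proof.
move=> xy xz nyz; have yz : y != z by apply: contraNneq nyz => ->.
have ayz := private_adj_nbrs xy xz yz.
by case/and4P: xy => _ y1 _ _; case/and4P: xz => _ z1 _ _; apply/and4P.
Qed.

(* Every vertex of the component is [private_adj]-adjacent to at least two of
   [a], [b], [c], so any two of them have a common neighbour among [a], [b], [c]. *)
Lemma component_clique a b c :
  cross a b -> cross a c -> cross b c ->
  forall u v, conn a u -> conn a v -> u != v -> adj u v.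
Proof.
move=> ab ac bc.
pose two a b c u := [|| cross u a && cross u b, cross u a && cross u c
                      | cross u b && cross u c].
(* If [v] shares the class of [a'], it is joined to [b'] through [u], and then to [c'] through [b'].
   If it shares the class of [b'], the roles of [a'] and [b'] are exchanged; otherwise it is joined
   to both through [u]. *)
have step a' b' c' u v : cross a' b' -> cross a' c' -> cross b' c' ->
    cross u a' -> cross u b' -> cross u v -> two a' b' c' v.
  move=> ab' ac' bc' ua ub uv; rewrite /two.
  have [-> | va] := eqVneq v a'; first by rewrite ab' ac' !orbT.
  have [-> | vb] := eqVneq v b'; first by rewrite private_adj_sym ab' bc' !orbT.
  have [na|na] := eqVneq (nbI v) (nbI a'); last first.
    have va' := private_adj_trans uv ua na; rewrite va' /=.
    have [nb|nb] := eqVneq (nbI v) (nbI b').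
      have nc : nbI v != nbI c' by rewrite nb; case/and4P: bc'.
      have av : cross a' v by rewrite private_adj_sym.
      by rewrite (private_adj_trans av ac' nc) !orbT.
    by rewrite (private_adj_trans uv ub nb).
  have nb : nbI v != nbI b' by rewrite na; case/and4P: ab'.
  have vb' := private_adj_trans uv ub nb; rewrite vb' /=.
  have bv : cross b' v by rewrite private_adj_sym.
  have nc : nbI v != nbI c' by rewrite na; case/and4P: ac'.
  by rewrite (private_adj_trans bv bc' nc) !orbT.
have twoP u : conn a u -> two a b c u.
  apply: (connect_invariant (P := fun u => two a b c u)); last first.
    by rewrite /two ab ac !orbT.
  move=> {}u v /or3P[] /andP[u1 u2] uv.
  - exact: step uv.
  - have : two a c b v by apply: step uv; rewrite // private_adj_sym.
    by rewrite /two [cross v c && _]andbC => /or3P[] ->; rewrite ?orbT.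
  - have : two b c a v by apply: step uv; rewrite // private_adj_sym.
    rewrite /two [cross v c && _]andbC [cross v b && cross v a]andbC.
    by case/or3P=> ->; rewrite ?orbT.
move=> u v /twoP tu /twoP tv uv.
have [t [tu' tv']] : exists t, cross t u /\ cross t v.
  case/or3P: tu tv => /andP[u1 u2] /or3P[] /andP[v1 v2];
  (have [s1 s2] : (exists t, cross u t /\ cross v t) by
     (by exists a) || (by exists b) || (by exists c));
  by exists s1; rewrite private_adj_sym [cross s1 v]private_adj_sym.
exact: private_adj_nbrs tu' tv' uv.
Qed.

(** A triangle of [private_adj] in the component makes it a clique. Without one, all
    [private_adj]-neighbours of a vertex have the same class, so that the classes alternate between
    those of [x] and [y] along every path. *)
Lemma component_dichotomy x y : cross x y ->
  (forall u v, conn x u -> conn x v -> u != v -> adj u v) \/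
  (forall u, conn x u -> nbI u = nbI x \/ nbI u = nbI y).
Proof.
move=> xy.
have [/existsP[a /andP[xa /existsP[b /existsP[c /and3P[ab ac bc]]]]]|] :=
  boolP [exists a, conn x a &&
    [exists b, exists c, [&& cross a b, cross a c & cross b c]]].
  by left=> u v xu xv; apply: (component_clique ab ac bc);
    apply: connect_trans (xu) || apply: connect_trans (xv); rewrite conn_sym.
move=> /existsPn nt; right=> u xu.
have same a b c : conn x a -> cross a b -> cross a c -> nbI b = nbI c.
  move=> xa ab ac; apply/eqP; apply: contraNT (nt a) => nbc.
  rewrite xa /=; apply/existsP; exists b; apply/existsP; exists c.
  by rewrite ab ac (private_adj_trans ab ac nbc).
pose P u := conn x u /\ ((nbI u = nbI x /\ forall v, cross u v -> nbI v = nbI y) \/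
                         (nbI u = nbI y /\ forall v, cross u v -> nbI v = nbI x)).
suff [_ [[]|[]]] : P u by auto.
apply: (connect_invariant (P := P)) xu; last first.
  by split=> //; left; split=> // v xv; apply: (same x).
move=> {}u v [xu H] uv.
have xv : conn x v by apply: connect_trans xu (connect1 uv).
have vu : cross v u by rewrite private_adj_sym.
split=> //; case: H => -[nu /(_ v uv) nv]; [right|left]; split=> // w vw;
by rewrite -nu; apply: same vw vu.
Qed.

(** In a clique, one vertex of each class may be chosen freely. When there are only two classes,
    arbitrary choices need not be adjacent, and the two ends of the given edge serve. *)
Lemma component_transversal x y : cross x y ->
  exists Q : {set G},
    [/\ forall q, q \in Q -> conn x q,
        forall q q', q \in Q -> q' \in Q -> q != q' -> cross q q'
      & forall u, conn x u -> exists2 q, q \in Q & nbI q = nbI u].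
Proof.
move=> xy; case: (component_dichotomy xy) => [clq|two]; last first.
  exists [set x; y]; split.
  - by move=> q; rewrite !inE => /orP[] /eqP-> //; apply: connect1.
  - move=> q q'; rewrite !inE => /orP[] /eqP-> /orP[] /eqP->; rewrite ?eqxx //.
    by rewrite private_adj_sym.
  - by move=> u /two[] ->; [exists x | exists y]; rewrite ?set21 ?set22.
have priv u : conn x u -> #|nbI u| == 1.
  apply: (connect_invariant (P := fun u => #|nbI u| == 1)).
    by move=> {}u v _ /and4P[].
  by case/and4P: xy.
pose r u := odflt x [pick v | conn x v && (nbI v == nbI u)].
have rP u : conn x u -> conn x (r u) && (nbI (r u) == nbI u).
  by move=> xu; rewrite /r; case: pickP => [//|/(_ u)]; rewrite xu eqxx.
exists [set r u | u in [pred u | conn x u]]; split.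
- by move=> _ /imsetP[u /= xu ->]; case/andP: (rP u xu).
- move=> _ _ /imsetP[u xu ->] /imsetP[v xv ->] nuv.
  have /andP[xru nru] := rP u xu; have /andP[xrv nrv] := rP v xv.
  apply/and4P; split; [exact: priv | exact: priv | | exact: clq].
  (* [r] depends only on the class, so distinct values of [r] have distinct classes. *)
  apply: contraNneq nuv => E; apply/eqP; congr odflt; apply: eq_pick => w /=.
  by rewrite -(eqP nru) -(eqP nrv) E.
- move=> u xu; exists (r u); first exact: imset_f.
  by case/andP: (rP u xu) => _ /eqP.
Qed.

Lemma private_transversal : exists Y : {set G},
  [/\ forall y, y \in Y -> exists u, cross y u,
      forall y y', y \in Y -> y' \in Y -> y != y' -> conn y y' -> cross y y'
    & forall x u, cross x u ->
        exists y, [/\ y \in Y, conn x y & nbI y = nbI x]].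
Proof.
have /fin_all_exists[Q QP] (x : G) : exists Q : {set G},
    (exists y, cross x y) ->
    [/\ forall q, q \in Q -> conn x q,
        forall q q', q \in Q -> q' \in Q -> q != q' -> cross q q'
      & forall u, conn x u -> exists2 q, q \in Q & nbI q = nbI u].
  have [/existsP[y /component_transversal[Q QP]]|/existsPn nx] :=
    boolP [exists y, cross x y]; first by exists Q.
  by exists set0 => -[y xy]; move: (nx y); rewrite xy.
have nbr u v : conn u v -> (exists w, cross u w) -> exists w, cross v w.
  move=> uv eu; apply: (connect_invariant (P := fun v => exists w, cross v w)) uv => //.
  by move=> a b _ ab; exists a; rewrite private_adj_sym.
(* Reading [Q] at the root makes all vertices of a component use the same transversal. *)
pose Y := [set y | [exists u, cross y u] && (y \in Q (comp_root y))].
have YP y : y \in Y -> (exists u, cross y u) /\ y \in Q (comp_root y).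
  by rewrite inE => /andP[/existsP].
have rootC u : conn (comp_root u) u by rewrite conn_sym connect_root.
have eroot u : (exists w, cross u w) -> exists w, cross (comp_root u) w.
  exact/nbr/connect_root.
exists Y; split.
- by move=> y /YP[].
- move=> y y' /YP[y1 yQ] /YP[y'1 y'Q] nyy' cyy'.
  have E : comp_root y = comp_root y'.
    by apply/eqP; rewrite root_connect //; exact: conn_sym.
  have [_ + _] := QP _ (eroot y y1); apply=> //; by rewrite E.
- move=> x u xu; have ex : exists w, cross x w by exists u.
  have [Q1 _ /(_ x (rootC x))[q qQ nq]] := QP _ (eroot x ex).
  have xq : conn x q by apply: connect_trans (connect_root _ x) (Q1 q qQ).
  exists q; split=> //; rewrite inE; apply/andP; split.
    exact/existsP/(nbr x).
  suff -> : comp_root q = comp_root x by [].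
  by apply/esym/eqP; rewrite root_connect //; exact: conn_sym.
Qed.

End IndependentSet.

(** * Representatives and the cliques they form around an element of the independent set *)

Section RootGraph.

Variables (G : sgraph) (I Y Z : {set G}).
Hypothesis clawG : claw_free G.
Hypothesis indI : forall i j, i \in I -> j \in I -> ~~ adj i j.
Hypothesis domI : forall v, v \notin I -> exists2 i, i \in I & adj v i.

Local Notation nbI := (nbrs_in I).
Local Notation cross := (private_adj I).
Local Notation comp_root := (fingraph.root cross).
Local Notation conn := (connect cross).

Hypothesis Y_cross : forall y, y \in Y -> exists u, cross y u.
Hypothesis Y_clique :
  forall y y', y \in Y -> y' \in Y -> y != y' -> conn y y' -> cross y y'.
Hypothesis Y_class : forall x u, cross x u ->
  exists y, [/\ y \in Y, conn x y & nbI y = nbI x].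

(** A pair of this form is already linked through the node of a component, so [Z] must contain no
    representative for it. Such a representative would also be adjacent to two elements of [I] whose
    classes meet one component, which [reps_outer_nbr] has to exclude. *)
Definition spanned (A : {set G}) :=
  exists y y', [/\ y \in Y, y' \in Y, conn y y' & A = nbI y :|: nbI y'].

Hypothesis Z_card : forall z, z \in Z -> #|nbI z| = 2.
Hypothesis Z_unspanned : forall z, z \in Z -> ~ spanned (nbI z).
Hypothesis Z_inj : {in Z &, injective nbI}.
Hypothesis Z_class : forall v, #|nbI v| = 2 ->
  spanned (nbI v) \/ exists2 z, z \in Z & nbI z = nbI v.

Let U := Y :|: Z.

Lemma Y_card y : y \in Y -> #|nbI y| = 1.
Proof. by case/Y_cross=> u /and4P[/eqP]. Qed.

Lemma reps_notin x : x \in U -> x \notin I.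
Proof.
move=> xU; apply/negP=> /(nbrs_in_self indI) nx.
by case/setUP: xU => [/Y_card|/Z_card]; rewrite nx cards0.
Qed.

Lemma reps_card2 x i j :
  x \in U -> i \in nbI x -> j \in nbI x -> i != j ->
  x \in Z /\ nbI x = [set i; j].
Proof.
move=> xU ix jx ij.
have sub : [set i; j] \subset nbI x.
  by apply/subsetP=> k /set2P[] ->.
have c2 : #|[set i; j]| = 2 by rewrite cards2 ij.
case/setUP: xU => [/Y_card|] xX; first by have := subset_leq_card sub; rewrite c2 xX.
by split=> //; apply/esym/eqP; rewrite eqEcard sub c2 Z_card.
Qed.

Lemma reps_far_adj x y : x \in U -> y \in U -> adj x y ->
  [disjoint nbI x & nbI y] -> [/\ x \in Y, y \in Y & cross x y].
Proof.
move=> xU yU xy dis.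
have cxy :=
  private_adj_of_disjoint clawG indI domI (reps_notin xU) (reps_notin yU) xy dis.
case/and4P: (cxy) => /eqP x1 /eqP y1 _ _; split=> //.
  by case/setUP: xU => // /Z_card; rewrite x1.
by case/setUP: yU => // /Z_card; rewrite y1.
Qed.

(** The vertex [t] supplies the third leaf of a claw at [y]. For [y] in [Y] it is a representative
    of another class of the same component; for [y] in [Z] it is the other neighbour of [y] in
    [I]. *)
Lemma reps_outer_nbr i y : y \in U -> i \in nbI y ->
  exists2 t, adj y t & forall x, x \in U -> i \in nbI x -> x != y ->
    x != t /\ ~~ adj x t.
Proof.
move=> yU iy; case/setUP: (yU) => [yY|yZ].
  have [u yu] := Y_cross yY; have uy : cross u y by rewrite private_adj_sym.
  have [y' [y'Y uy' ny']] := Y_class uy.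
  have nyy' : nbI y != nbI y' by rewrite ny'; case/and4P: yu.
  have nyy : y != y' by apply: contraNneq nyy' => ->.
  have cyy' : conn y y' by apply: connect_trans (connect1 yu) uy'.
  have xyy' := Y_clique yY y'Y nyy cyy'.
  have /eqP/cards1P[i' Ey] := Y_card yY; have /eqP/cards1P[j Ey'] := Y_card y'Y.
  have ii' : i' = i by apply/eqP; rewrite eq_sym -in_set1 -Ey.
  rewrite {i'}ii' in Ey.
  have ij : i != j by apply: contraNneq nyy' => ij; rewrite Ey Ey' ij.
  exists y'; first by case/and4P: xyy'.
  move=> x xU ix xy; split.
    by apply: contraNneq ij => xy'; rewrite xy' Ey' in_set1 in ix.
  apply/negP => axy'.
  have [dis|] := boolP [disjoint nbI x & nbI y'].
    have y'U : y' \in U by rewrite inE y'Y.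
    have [xY _ cxy'] := reps_far_adj xU y'U axy' dis.
    have cxy : conn x y by apply: connect_trans (connect1 cxy') _; rewrite conn_sym.
    case/and4P: (Y_clique xY yY xy cxy) => _ _ /negP[].
    have /eqP/cards1P[k Ex] := Y_card xY.
    by move: ix; rewrite Ex Ey in_set1 => /eqP->.
  rewrite -setI_eq0 => /set0Pn[k]; rewrite inE => /andP[kx].
  rewrite Ey' in_set1 => /eqP kj; rewrite {k}kj in kx.
  (* Here [x] would represent the pair [i], [j], which is spanned by [y] and [y']. *)
  have [xZ Ex] := reps_card2 xU ix kx ij; case: (Z_unspanned xZ).
  by exists y, y'; split=> //; rewrite Ex Ey Ey'.
have /eqP/cards2P[a [b [ab Ey]]] := Z_card yZ.
have [j ij Ey'] : exists2 j, i != j & nbI y = [set i; j].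
  move: iy; rewrite Ey => /set2P[] ->; first by exists b.
  by exists a; rewrite 1?eq_sym // setUC.
have jy : j \in nbI y by rewrite Ey' set22.
have /nbrs_inP[jI yj] := jy; exists j => // x xU ix xy; split.
  by apply: contraTneq jI => <-; apply: reps_notin.
apply/negP => xj; have jx : j \in nbI x by apply/nbrs_inP.
have [xZ Ex] := reps_card2 xU ix jx ij.
by case/eqP: xy; apply: Z_inj; rewrite // Ey' Ex.
Qed.

(** Otherwise [x], [w] and the outer neighbour of [y] would be the leaves of a claw at [y]. *)
Lemma reps_adj_trans i x y w :
  x \in U -> y \in U -> w \in U -> i \in nbI x -> i \in nbI y -> i \in nbI w ->
  x != w -> adj x y -> adj y w -> adj x w.
Proof.
move=> xU yU wU ix iy iw xw xy yw.
have ne (a b : G) : adj a b -> a != b by apply: contraTneq => ->; rewrite adj_irr.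
have [t yt far] := reps_outer_nbr yU iy.
have [xt /negbTE nxt] := far x xU ix (ne _ _ xy).
have wy : w != y by rewrite eq_sym ne.
have [wt /negbTE nwt] := far w wU iw wy.
rewrite adj_sym in xy; have := claw_free_nbrs clawG xy yw yt xw xt wt.
by rewrite nxt nwt !orbF.
Qed.

(* The representatives at [i] form at most two cliques: [side] tells them apart. *)
Definition side (i x : G) : bool :=
  if [pick p in U | adj p i] is Some p then (x == p) || adj x p else true.

Lemma adj_side i x y : x \in U -> y \in U -> i \in nbI x -> i \in nbI y ->
  x != y -> adj x y = (side i x == side i y).
Proof.
move=> xU yU ix iy xy; rewrite /side.
have /nbrs_inP[iI xi] := ix; have /nbrs_inP[_ yi] := iy.
case: pickP => [p /andP[pU pi]|/(_ x)]; last by rewrite xU xi.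
have ip : i \in nbI p by apply/nbrs_inP.
have [xp|xp] /= := eqVneq x p.
  have /negbTE-> /= : y != p by rewrite -xp eq_sym.
  by rewrite xp adj_sym; case: adj.
have [->|yp] /= := eqVneq y p; first by case: adj.
have [axp|naxp] := boolP (adj x p); have [ayp|nayp] := boolP (adj y p).
- rewrite eqxx; apply: (reps_adj_trans xU pU yU ix ip iy) => //.
  by rewrite adj_sym.
- apply: contraNF nayp => axy; rewrite adj_sym in axy.
  by exact: (reps_adj_trans yU xU pU iy ix ip).
- apply: contraNF naxp => axy.
  by exact: (reps_adj_trans xU yU pU ix iy ip).
(* With neither [x] nor [y] adjacent to [p], only the edge [xy] can prevent a claw at [i]. *)
- rewrite adj_sym in xi; rewrite adj_sym in yi; rewrite adj_sym in pi.
  have := claw_free_nbrs clawG xi yi pi xy xp yp.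
  by rewrite (negbTE naxp) (negbTE nayp) !orbF eqxx.
Qed.

(** * The root graph of the chosen representatives *)

Definition node : Type := ((G * bool) + G)%type.
HB.instance Definition _ := Finite.copy node ((G * bool) + G)%type.

(** The element [i] lies in both of its cliques and so becomes an edge between its two nodes. Labels
    [inl (i, b)] with [i] outside [I], and [inr c] with [c] not the root of a component meeting [Y],
    get empty cliques and are isolated nodes. *)
Definition clique_of (n : node) : {set G} :=
  match n with
  | inl (i, b) => [set x | (i \in I) &&
      ((x == i) || [&& x \in U, adj x i & side i x == b])]
  | inr c => [set y in Y | comp_root y == c]
  end.

Lemma clique_of_I i b x : (x \in clique_of (inl (i, b))) =
  (i \in I) && ((x == i) || [&& x \in U, adj x i & side i x == b]).
Proof. by rewrite inE. Qed.

Lemma clique_of_comp c x :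
  (x \in clique_of (inr c)) = (x \in Y) && (comp_root x == c).
Proof. by rewrite !inE. Qed.

Lemma clique_of_domain n x : x \in clique_of n -> x \in I \/ x \in U.
Proof.
case: n => [[i b]|c]; rewrite ?clique_of_I ?clique_of_comp.
  by case/andP=> iI /orP[/eqP->|/and3P[]]; [left|right].
by case/andP=> xY _; right; rewrite inE xY.
Qed.

(** An element of [I] lies in its two sides, a vertex of [Y] in one side and one component, and a
    vertex of [Z] in one side at each of its two neighbours in [I]. *)
Lemma clique_of_two x : exists n1 n2, forall n, x \in clique_of n -> n = n1 \/ n = n2.
Proof.
have [xI|xI] := boolP (x \in I).
  exists (inl (x, true)), (inl (x, false)) => -[[i b]|c].
    rewrite clique_of_I => /andP[iI /orP[/eqP<-|/and3P[_ xi _]]].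
      by case: b; [left|right].
    by case/negP: (indI xI iI).
  rewrite clique_of_comp => /andP[xY _].
  have /reps_notin : x \in U by rewrite inE xY.
  by rewrite xI.
have [xU|xU] := boolP (x \in U); last first.
  exists (inr x), (inr x) => n /clique_of_domain.
  by rewrite (negbTE xI) (negbTE xU) => -[].
have inlP i b : x \in clique_of (inl (i, b)) -> i \in nbI x /\ b = side i x.
  rewrite clique_of_I => /andP[iI /orP[/eqP xi|/and3P[_ xi /eqP<-]]].
    by rewrite xi iI in xI.
  by split=> //; apply/nbrs_inP.
case/setUP: xU => [xY|xZ].
  have /eqP/cards1P[i Ex] := Y_card xY.
  exists (inl (i, side i x)), (inr (comp_root x)) => -[[j b]|c].
    by move=> /inlP[]; rewrite Ex in_set1 => /eqP-> ->; left.
  by rewrite clique_of_comp => /andP[_ /eqP<-]; right.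
have /eqP/cards2P[i [j [_ Ex]]] := Z_card xZ.
exists (inl (i, side i x)), (inl (j, side j x)) => -[[k b]|c].
  by move=> /inlP[]; rewrite Ex => /set2P[]-> ->; [left|right].
by rewrite clique_of_comp => /andP[/Y_card]; rewrite Z_card.
Qed.

Lemma adj_clique_of x y n m : x != y -> x \in clique_of n -> y \in clique_of m ->
  adj x y <-> exists k, (x \in clique_of k) && (y \in clique_of k).
Proof.
move=> xy /clique_of_domain xX /clique_of_domain yX; split=> [axy|].
  case: xX yX => [xI|xU] [yI|yU].
  - by case/negP: (indI xI yI).
  - exists (inl (x, side x y)); rewrite !clique_of_I xI eqxx yU adj_sym axy eqxx.
    by rewrite orbT.
  - by exists (inl (y, side y x)); rewrite !clique_of_I yI !eqxx xU axy orbT.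
  have [dis|] := boolP [disjoint nbI x & nbI y].
    have [xY yY cxy] := reps_far_adj xU yU axy dis.
    exists (inr (comp_root x)); rewrite !clique_of_comp xY yY eqxx /=.
    rewrite root_connect; last exact: conn_sym.
    by apply: connect1; rewrite private_adj_sym.
  rewrite -setI_eq0 => /set0Pn[i]; rewrite in_setI => /andP[ix iy].
  have /nbrs_inP[iI xi] := ix; have /nbrs_inP[_ yi] := iy.
  exists (inl (i, side i x)); rewrite !clique_of_I iI xU yU xi yi eqxx.
  by rewrite [side i y == _]eq_sym -adj_side // axy !orbT.
case=> -[[i b]|c].
  rewrite !clique_of_I => /andP[/andP[iI xi] /andP[_ yi]].
  case/orP: xi yi => [/eqP xi|/and3P[xU' xi /eqP bx]]
    /orP[/eqP yi|/and3P[yU' yi /eqP yb]].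
  - by case/eqP: xy; rewrite xi yi.
  - by rewrite xi adj_sym.
  - by rewrite yi.
  - rewrite (@adj_side i) ?bx ?yb //; by apply/nbrs_inP.
rewrite !clique_of_comp => /andP[/andP[xY /eqP <-] /andP[yY]].
rewrite root_connect; last exact: conn_sym.
by rewrite conn_sym => /(Y_clique xY yY xy) /and4P[].
Qed.

Definition node_adj : rel node := fun n m =>
  (n != m) && [exists x, (x \in clique_of n) && (x \in clique_of m)].

Lemma node_adj_sym : symmetric node_adj.
Proof.
by move=> n m; rewrite /node_adj eq_sym; under eq_existsb => x do rewrite andbC.
Qed.

Lemma node_adj_irr : irreflexive node_adj.
Proof. by move=> n; rewrite /node_adj eqxx. Qed.

Definition root_graph : sgraph := SGraph node_adj_sym node_adj_irr.

Lemma node_adj_of x (n m : root_graph) :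
  n != m -> x \in clique_of n -> x \in clique_of m -> adj n m.
Proof.
by move=> nm xn xm; rewrite /= /node_adj nm; apply/existsP; exists x; rewrite xn.
Qed.

Lemma root_graph_line S :
  has_subgraph root_graph S -> has_induced_subgraph G (line_graph S).
Proof.
apply: (@line_graph_of_krausz G root_graph S clique_of).
- by move=> n m /andP[_ /existsP].
- move=> x n m k xn xm xk; have [n1 [n2 two]] := clique_of_two x.
  by case: (two n xn) (two m xm) (two k xk) => -> [] -> [] ->; rewrite eqxx ?orbT.
- exact: adj_clique_of.
Qed.

(** * Bags for the blow-up: coverage, connectedness and size *)

Definition component (c : G) : {set G} :=
  [set u | [exists w, cross u w] && (comp_root u == c)].

Definition component_classes (c : G) : {set G} := \bigcup_(u in component c) nbI u.

(* Edges of [G] joining classes of the same component are lost in the root graph,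
   so the bag of a component also receives all vertices between its classes. *)
Definition bag_of (n : root_graph) : {set G} :=
  match n with
  | inl (i, b) => if i \in I then i |: [set v | adj i v] else set0
  | inr c => component c :|:
      [set v | (#|nbI v| == 2) && (nbI v \subset component_classes c)]
  end.

Lemma bag_of_I i b v : i \in I -> (v \in bag_of (inl (i, b))) = (v == i) || adj i v.
Proof. by move=> iI; rewrite /= iI !inE. Qed.

Lemma bag_of_comp_classes c v : v \in bag_of (inr c) -> nbI v \subset component_classes c.
Proof.
rewrite !in_setU => /orP[vC|]; last by rewrite inE => /andP[].
exact: bigcup_sup.
Qed.

Lemma bag_of_comp_notin c v : v \in bag_of (inr c) -> v \notin I.
Proof.
move=> vc; apply/negP => /(nbrs_in_self indI) nv.
move: vc; rewrite !inE nv cards0 andFb orbF => /andP[/existsP[w /and3P[]]].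
by rewrite nv cards0.
Qed.

Lemma component_mem u w : cross u w -> u \in component (comp_root u).
Proof. by move=> uw; rewrite inE eqxx andbT; apply/existsP; exists w. Qed.

Lemma bag_of_vertex v : exists n, v \in bag_of n.
Proof.
have [vI|/domI[i iI vi]] := boolP (v \in I).
  by exists (inl (v, true)); rewrite bag_of_I // eqxx.
by exists (inl (i, true)); rewrite bag_of_I // adj_sym vi orbT.
Qed.

Lemma bag_of_edge u v : adj u v -> exists n, (u \in bag_of n) && (v \in bag_of n).
Proof.
move=> uv.
have [uI|uI] := boolP (u \in I).
  by exists (inl (u, true)); rewrite !bag_of_I // eqxx uv orbT.
have [vI|vI] := boolP (v \in I).
  by exists (inl (v, true)); rewrite !bag_of_I // eqxx adj_sym uv orbT.
have [dis|] := boolP [disjoint nbI u & nbI v].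
  have cuv := private_adj_of_disjoint clawG indI domI uI vI uv dis.
  have cvu : cross v u by rewrite private_adj_sym.
  exists (inr (comp_root u)); rewrite !in_setU (component_mem cuv) /=.
  suff -> : comp_root u = comp_root v by rewrite (component_mem cvu).
  by apply/eqP; rewrite root_connect ?connect1 //; exact: conn_sym.
rewrite -setI_eq0 => /set0Pn[i]; rewrite in_setI => /andP[].
move=> /nbrs_inP[iI ui] /nbrs_inP[_ vi]; exists (inl (i, true)).
by rewrite !bag_of_I // adj_sym ui adj_sym vi !orbT.
Qed.

Section Trace.

Variable v : G.

Let tr : rel root_graph := [rel a b | [&& adj a b, v \in bag_of a & v \in bag_of b]].

Lemma trace_sym : connect_sym tr.
Proof.
apply: sym_connect_sym => a b; rewrite /tr /= [node_adj _ _]node_adj_sym.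
by rewrite [(v \in bag_of a) && _]andbC.
Qed.

Lemma trace_clique x (n m : root_graph) : x \in clique_of n -> x \in clique_of m ->
  v \in bag_of n -> v \in bag_of m -> connect tr n m.
Proof.
move=> xn xm vn vm; have [->|nm] := eqVneq n m; first exact: connect0.
by apply: connect1; apply/and3P; split=> //; apply: node_adj_of xn xm.
Qed.

Lemma trace_sides i b b' : i \in I -> v \in bag_of (inl (i, b)) ->
  connect tr (inl (i, b)) (inl (i, b')).
Proof.
by move=> iI vi; apply: (@trace_clique i); rewrite ?clique_of_I ?iI ?eqxx.
Qed.

(** The link is the representative [y] of the class of [i] in the component: it lies both in a side
    of [i] and in the clique of the component. *)
Lemma trace_class_comp i b c : i \in nbI v -> v \in bag_of (inr c) ->
  connect tr (inl (i, b)) (inr c).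
Proof.
move=> iv vc; have /nbrs_inP[iI vi] := iv.
have vib b' : v \in bag_of (inl (i, b')) by rewrite bag_of_I // adj_sym vi orbT.
have /bigcupP[u uC iu] := subsetP (bag_of_comp_classes vc) i iv.
move: uC; rewrite inE => /andP[/existsP[w /Y_class[y [yY uy ny]]] /eqP cu].
apply: connect_trans (trace_sides (side i y) iI (vib b)) _.
have /nbrs_inP[_ yi] : i \in nbI y by rewrite ny.
apply: (@trace_clique y) => //.
  by rewrite clique_of_I iI in_setU yY yi eqxx orbT.
by rewrite clique_of_comp yY -cu root_connect 1?conn_sym //; exact: conn_sym.
Qed.

Lemma trace_connected n m : v \in bag_of n -> v \in bag_of m -> connect tr n m.
Proof.
suff [n0 H] : exists n0, forall n, v \in bag_of n -> connect tr n n0.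
  by move=> /H nn0 /H; rewrite trace_sym; apply: connect_trans.
have [vI|vI] := boolP (v \in I).
  exists (inl (v, true)) => -[[i b]|c] vn; last by case/negP: (bag_of_comp_notin vn).
  have [iI|iI] := boolP (i \in I); last by rewrite /= (negbTE iI) inE in vn.
  move: (vn); rewrite bag_of_I // => /orP[/eqP E|iv]; last by case/negP: (indI iI vI).
  by rewrite -E in vn *; apply: trace_sides.
have inlP i b : v \in bag_of (inl (i, b)) -> i \in nbI v.
  have [iI|iI] := boolP (i \in I); last by rewrite /= (negbTE iI) inE.
  rewrite bag_of_I // => /orP[/eqP E|iv]; first by rewrite E iI in vI.
  by apply/nbrs_inP; rewrite adj_sym.
have inlI i b : v \in bag_of (inl (i, b)) -> i \in I by move=> /inlP/nbrs_inP[].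
have nbIl i b : i \in nbI v -> v \in bag_of (inl (i, b)).
  by move=> /nbrs_inP[iI vi]; rewrite bag_of_I // adj_sym vi orbT.
have [c1|c2] := card_nbrs_in clawG indI domI vI.
  have /eqP/cards1P[i E] := c1; have iv : i \in nbI v by rewrite E set11.
  exists (inl (i, true)) => -[[j b]|c] vn.
    have ji : j = i by apply/eqP; rewrite -in_set1 -E (inlP j b).
    by rewrite -ji; apply: trace_sides => //; apply: inlI vn.
  by rewrite trace_sym; apply: trace_class_comp.
have /eqP/cards2P[i [j [ij E]]] := c2.
have iv : i \in nbI v by rewrite E set21.
have jv : j \in nbI v by rewrite E set22.
have comp c b : v \in bag_of (inr c) -> connect tr (inr c) (inl (i, b)).
  by rewrite trace_sym; apply: trace_class_comp.
exists (inl (i, true)) => -[[k b]|c] vn; last exact: comp.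
have kI := inlI _ _ vn.
have /set2P[] : k \in [set i; j] by rewrite -E (inlP k b).
  by move=> <-; apply: trace_sides.
move=> kj; rewrite {k}kj in vn kI *; have [iI vi] := nbrs_inP _ _ _ iv.
(* The nodes of [i] and [j] are linked through the component spanning the pair, whose bag contains
   [v], or else directly by the edge [z] between suitable sides. *)
have [[y [y' [yY y'Y yy' Evy]]]|[z zZ Ez]] := Z_class c2.
  have mem w w' : w \in Y -> w' \in Y -> conn w w' ->
      nbI w \subset component_classes (comp_root w').
    move=> wY w'Y ww'; have [u wu] := Y_cross wY.
    apply: (bigcup_sup w); have := component_mem wu.
    suff -> : comp_root w = comp_root w' by [].
    by apply/eqP; rewrite root_connect //; exact: conn_sym.
  have vc : v \in bag_of (inr (comp_root y')).
    rewrite !inE c2 eqxx /= Evy subUset (mem y y') //= (mem y' y') ?connect0 //.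
    by rewrite orbT.
  exact: connect_trans (trace_class_comp b jv vc) (comp _ _ vc).
have zU : z \in U by rewrite in_setU zZ orbT.
have zi : adj z i by have /nbrs_inP[] : i \in nbI z by rewrite Ez.
have zj : adj z j by have /nbrs_inP[] : j \in nbI z by rewrite Ez.
apply: connect_trans (trace_sides (side j z) kI vn) _.
apply: connect_trans (trace_sides true iI (nbIl i (side i z) iv)).
by apply: (@trace_clique z); rewrite ?clique_of_I ?iI ?kI ?zU ?zi ?zj ?eqxx ?orbT ?nbIl.
Qed.

End Trace.

(** Double counting of the edges between the bag and [component_classes c]: a vertex of the
    component sends one such edge and is counted once more by the last term, and any other vertex of
    the bag sends two. *)
Lemma card_component_bag D c : max_degree_le G D ->
  2 * #|bag_of (inr c)| <= #|component_classes c| * D + #|component c|.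
Proof.
move=> degG; set J := component_classes c; set C := component c.
set W := bag_of (inr c).
pose d v := \sum_(j in J) adj v j.
have dE v : nbI v \subset J -> #|nbI v| <= d v.
  move=> nv; rewrite -sum1_card /d [X in X <= _]big_mkcond [X in _ <= X]big_mkcond /=.
  apply: leq_sum => j _; have [jv|//] := boolP (j \in nbI v).
  by rewrite (subsetP nv) //; case/nbrs_inP: jv => _ ->.
have dC v : v \in C -> 2 <= d v + 1.
  move=> vC; rewrite addn1 ltnS; apply: leq_trans (dE v _); last exact: bigcup_sup.
  by move: vC; rewrite inE => /andP[/existsP[w /and4P[/eqP->]]].
have dW v : v \in W -> 2 <= d v + (v \in C).
  rewrite in_setU => /orP[vC|]; first by rewrite vC dC.
  by rewrite inE => /andP[/eqP c2 /dE]; rewrite c2 => /leq_trans; apply; rewrite leq_addr.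
rewrite mulnC -sum_nat_const.
apply: (@leq_trans (\sum_(v in W) (d v + (v \in C)))); first exact: leq_sum.
rewrite big_split /= leq_add //.
  rewrite exchange_big /= -sum_nat_const leq_sum // => j _.
  apply: leq_trans (degG j).
  rewrite -sum1_card [X in X <= _]big_mkcond [X in _ <= X]big_mkcond /=.
  by apply: leq_sum => v _; rewrite inE adj_sym; case: (v \in W); case: adj.
rewrite -sum1_card [X in X <= _]big_mkcond [X in _ <= X]big_mkcond /=.
by apply: leq_sum => v _; case: (v \in W); case: (v \in C).
Qed.

Lemma card_bag_of D n : 0 < D -> max_degree_le G D -> 2 * #|bag_of n| <= D.+1 ^ 2.
Proof.
move=> D0 degG; case: n => [[i b]|c].
  rewrite /bag_of; case: (i \in I); last by rewrite cards0.
  rewrite cardsU1; have := degG i; case: (_ \notin _); nia.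
apply: leq_trans (card_component_bag c degG) _.
have [C0|[x xC]] := set_0Vmem (component c).
  by rewrite /component_classes C0 big_set0 !cards0.
have Cx u : u \in component c -> conn x u.
  move: xC; rewrite !inE => /andP[_ /eqP<-] /andP[_].
  by rewrite root_connect 1?conn_sym //; exact: conn_sym.
have C1 u : u \in component c -> #|nbI u| = 1.
  by rewrite inE => /andP[/existsP[w /and4P[/eqP]]].
have [y xy] : exists y, cross x y by move: xC; rewrite inE => /andP[/existsP].
have [clq|two] := component_dichotomy clawG indI xy.
  have CD : #|component c| <= D.+1.
    apply: (@leq_trans #|x |: [set w | adj x w]|).
      apply/subset_leq_card/subsetP => u uC; rewrite !inE.
      have [//|ux] /= := eqVneq u x.
      by rewrite eq_sym in ux; apply: clq; rewrite ?Cx.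
    by rewrite cardsU1; have := degG x; case: (_ \notin _) => /=; lia.
  have JC : #|component_classes c| <= #|component c|.
    apply: leq_trans (leq_card_bigcup _ _) _.
    by rewrite -sum1_card; apply: leq_sum => u /C1 ->.
  (* With at most [D + 1] vertices and no more classes than vertices, the bound is
     [(D + 1) * D + (D + 1)]. *)
  nia.
have /cards1P[i Ex] : #|nbI x| == 1 by rewrite C1.
have /cards1P[j Ey] : #|nbI y| == 1 by case/and4P: xy.
have J2 : #|component_classes c| <= 2.
  apply: (@leq_trans #|[set i; j]|); last by rewrite cards2; case: (_ != _).
  apply/subset_leq_card/bigcupsP => u /Cx/two[] ->; rewrite ?Ex ?Ey sub1set;
  by rewrite ?set21 ?set22.
have CD : #|component c| <= 2 * D.
  apply: (@leq_trans #|[set w | adj i w] :|: [set w | adj j w]|).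
    apply/subset_leq_card/subsetP => u /Cx/two nu; rewrite !inE ![adj _ u]adj_sym.
    have [k [kk ku]] : exists k, (k = i \/ k = j) /\ k \in nbI u.
      by case: nu => ->; [exists i; rewrite Ex set11 | exists j; rewrite Ey set11]; auto.
    have /nbrs_inP[_] := ku; by case: kk => -> ->; rewrite ?orbT.
  apply: leq_trans (leq_card_setU _ _) _.
  by rewrite mul2n -addnn leq_add.
(* With two classes of at most [D] vertices each, the bound is [2 * D + 2 * D], and
   [4 * D <= (D + 1) ^ 2]. *)
nia.
Qed.

End RootGraph.

(** * Assembly of the root graph and comparison of treewidths *)

Lemma claw_free_root_graph (G : sgraph) : claw_free G ->
  exists H : sgraph,
    [/\ forall S, has_subgraph H S -> has_induced_subgraph G (line_graph S),
        G -> exists n m : H, adj n m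
      & forall D m, 0 < D -> max_degree_le G D -> has_decomposition_of_size H m ->
          exists2 m', has_decomposition_of_size G m' & 2 * m' <= m * D.+1 ^ 2].
Proof.
move=> clawG; have [I [indI domI]] := maximal_independent_set G.
have [Y [Y1 Y2 Y3]] := private_transversal clawG indI.
(* The test with [pick] keeps one canonical vertex for each unspanned pair. *)
pose Z := [set v | (#|nbrs_in I v| == 2) && ~~ `[< spanned I Y (nbrs_in I v) >] &
                   [pick u | nbrs_in I u == nbrs_in I v] == Some v].
have Z1 z : z \in Z -> #|nbrs_in I z| = 2 by rewrite inE => /andP[/andP[/eqP]].
have Z2 z : z \in Z -> ~ spanned I Y (nbrs_in I z).
  by rewrite inE => /andP[/andP[_ /asboolPn]].
have Z3 : {in Z &, injective (nbrs_in I)}.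
  move=> z z'; rewrite !inE => /andP[_ /eqP Ez] /andP[_ /eqP Ez'] E.
  by apply: Some_inj; rewrite -Ez -Ez' E.
have Z4 v : #|nbrs_in I v| = 2 ->
    spanned I Y (nbrs_in I v) \/ exists2 z, z \in Z & nbrs_in I z = nbrs_in I v.
  move=> c2; have [sp|nsp] := EM (spanned I Y (nbrs_in I v)); [by left|right].
  case Ez: [pick u | nbrs_in I u == nbrs_in I v] => [z|]; last first.
    by case: pickP Ez => // /(_ v); rewrite eqxx.
  have nz : nbrs_in I z = nbrs_in I v by case: pickP Ez => // u /eqP ? [<-].
  by exists z; rewrite // inE nz c2 eqxx Ez eqxx andbT; apply/asboolPn.
exists (root_graph I Y Z); split.
- by move=> S; apply: root_graph_line.
(* The two nodes of any [i] in [I] are adjacent, since [i] lies in both cliques; this edge later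
   gives treewidth at least 1. *)
- move=> v; have [i iI] : exists i, i \in I.
    by have [vI|/domI[i iI _]] := boolP (v \in I); [exists v | exists i].
  exists (inl (i, true)), (inl (i, false)).
  by apply: (node_adj_of (x := i)); [apply/eqP | |]; rewrite ?clique_of_I ?iI ?eqxx.
- move=> D m D0 degG; apply: (decomposition_blowup (W := @bag_of _ I Y Z)).
  + exact: bag_of_vertex.
  + exact: bag_of_edge.
  + by move=> x n n'; apply: trace_connected.
  + by move=> n; apply: card_bag_of.
Qed.

Lemma decomposition_size_treewidth (G : sgraph) :
  exists2 s, has_decomposition_of_size G s & treewidth G = (s%:Z - 1)%R.
Proof. by rewrite /treewidth; case: ex_minnP => s /asboolP hs _; exists s. Qed.

Lemma treewidth_le_size (G : sgraph) (m : nat) :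
  has_decomposition_of_size G m -> (treewidth G <= m%:Z - 1)%R.
Proof.
move=> hm; rewrite /treewidth; case: ex_minnP => s _ /(_ m (asboolT hm)).
by rewrite lerD2r lez_nat.
Qed.

Local Open Scope ring_scope.

Theorem theorem3p6 (R : realType) (Delta k : nat) (c1 c2 : R) :
  (0 < Delta)%N -> (0 < k)%N ->
  (forall (l : nat) (H : sgraph), (0 < l)%N ->
     ~ (exists S : sgraph, is_subdivision (wall l l) S /\ has_subgraph H S) ->
     (treewidth H)%:~R <= wall_bound c1 c2 l) ->
  forall G : sgraph,
    claw_free G -> max_degree_le G Delta ->
    ~ (exists S : sgraph, is_subdivision (wall k k) S /\
                          has_induced_subgraph G (line_graph S)) ->
    (treewidth G)%:~R <= w_bound c1 c2 Delta k.
Proof.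
move=> D0 k0 wallP G clawG degG noL.
have [H [lineH edgeH sizeH]] := claw_free_root_graph clawG.
have {wallP lineH noL} twH : (treewidth H)%:~R <= wall_bound c1 c2 k.
  apply: wallP => // -[S [subS HS]]; apply: noL.
  by exists S; split=> //; apply: lineH.
rewrite /w_bound; set w := wall_bound _ _ _ in twH *.
(* For empty [G] the treewidth is -1, and the term [6 * (Delta + 1)] suffices whatever the sign of
   the wall bound. *)
have [x _|G0] := pickP (xpredT : pred G); last first.
  have [s [T [B [_ maxB]]] ->] := decomposition_size_treewidth G.
  have -> : s = 0%N.
    apply/eqP; rewrite -leqn0 -maxB; apply/bigmax_leqP => t _.
    by rewrite leqn0 cards_eq0; apply/eqP/setP => y; have := G0 y.
  rewrite sub0r mulrN1z lerBrDr addNr le_max; apply/orP; right.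
  by rewrite mulr_ge0 ?ler0n.
have [n [m nm]] := edgeH x.
have [s Hs Es] := decomposition_size_treewidth H.
have s2 := decomposition_size_edge nm Hs.
have [m' Gm' le_m'] := sizeH _ _ D0 degG Hs.
(* From [2 * m' <= s * (Delta + 1) ^ 2], using [s <= 2 * (s - 1)] for [s >= 2]. This replaces the
   bag size [s] of [H] by its treewidth [s - 1]. *)
have m'_le : (m' <= (s - 1) * Delta.+1 ^ 2)%N by nia.
apply: (@le_trans _ _ (m'%:R - 1)).
  have := treewidth_le_size Gm'; rewrite -(ler_int R) => /le_trans; apply.
  by rewrite intrB.
rewrite lerD2r le_max; apply/orP; left.
apply: (@le_trans _ _ ((s - 1) * Delta.+1 ^ 2)%N%:R); first by rewrite ler_nat.
rewrite natrM natrX ler_wpM2r ?exprn_ge0 ?ler0n //.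
apply: le_trans twH; rewrite Es intrB natrB //; exact: ltnW.
Qed.
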